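(* For every $n\in\mathbb{N}$, $n\ge 1$, let $\mathcal{T}=\{w\to Q(w): w\in A^*,\ w\ne Q(w),\ |w|\le\max\{2n,4\}\}$. Then $(A,\mathcal{T})$ is a finite complete rewriting system presenting the hypoplactic monoid $H_n$ of rank $n$.
   Context: Let $A=\{1<2<\dots<n\}$. Let $\mathcal{R}=\{(acb,cab):a\le b<c\}\cup\{(bac,bca):a<b\le c\}$ and $\mathcal{S}=\{(cadb,acbd):a\le b<c\le d\}\cup\{(bdac,dbca):a<b\le c<d\}$, with $a,b,c,d\in A$. The hypoplactic monoid of rank $n$, denoted $H_n$, is the monoid presented by $\langle A\mid\mathcal{R}\cup\mathcal{S}\rangle$. A column is a strictly decreasing word in $A^*$. Any word $\alpha\in A^*$ has a unique decomposition $\alpha=\alpha^{(1)}\cdots\alpha^{(k)}$ as a product of columns of maximal length. The word $\alpha$ is a quasi-ribbon word if, for all $i=1,\dots,k-1$, the last (smallest) symbol of $\alpha^{(i+1)}$ is greater than or equal to the first (greatest) symbol of $\alpha^{(i)}$. By a known theorem of Novelli, the quasi-ribbon words form a cross-section of $H_n$ (each element of $H_n$ is represented by exactly one quasi-ribbon word). For $w\in A^*$, $Q(w)$ denotes the unique quasi-ribbon word representing the same element of $H_n$ as $w$; $|w|$ is the length of $w$. Rewriting systems: $(A,\mathcal{T})$ consists of a finite alphabet $A$ and a set $\mathcal{T}\subseteq A^*\times A^*$ of rules $\ell\to r$; $u\to v$ in one step if $u=x\ell y$, $v=xry$ for a rule $\ell\to r$ and words $x,y$; $\to^*$ is the reflexive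 transitive closure. The system is finite if $A$ and $\mathcal{T}$ are finite; noetherian if there is no infinite sequence $u_1\to u_2\to\cdots$; confluent if $u\to^*u'$ and $u\to^*u''$ imply there is $v$ with $u'\to^*v$ and $u''\to^*v$; complete if it is noetherian and confluent. It presents a monoid $M$ if the quotient of $A^*$ by the congruence generated by $\mathcal{T}$ is $M$. *)

(* Defs.v *)
From Stdlib Require Import Relation_Operators.
From HB Require Import structures.
From mathcomp Require Import all_boot.
From mathcomp Require Import boolp classical_sets functions cardinality.

Set Implicit Arguments.
Unset Strict Implicit.
Unset Printing Implicit Defensive.

Local Open Scope classical_set_scope.

(* A rule l -> r is the pair (l, r). *)

Definition rewriting_system (A : Type) := set (seq A * seq A).

Section Rewriting.
Variables (A : Type) (T : rewriting_system A).

Definition rewrite_step (u v : seq A) : Prop :=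
  exists x y l r, [/\ T (l, r), u = x ++ l ++ y & v = x ++ r ++ y].

Definition rewrites : seq A -> seq A -> Prop :=
  clos_refl_trans (seq A) rewrite_step.

Definition finite_system : Prop := finite_set [set: A] /\ finite_set T.

Definition noetherian : Prop :=
  ~ exists f : nat -> seq A, forall i, rewrite_step (f i) (f i.+1).

Definition confluent : Prop :=
  forall u u' u'', rewrites u u' -> rewrites u u'' ->
  exists v, rewrites u' v /\ rewrites u'' v.

Definition complete_system : Prop := noetherian /\ confluent.

(* The least congruence on the free monoid containing T. *)
Inductive congr_gen : seq A -> seq A -> Prop :=
| congr_rule l r : T (l, r) -> congr_gen l r
| congr_refl u : congr_gen u u
| congr_sym u v : congr_gen u v -> congr_gen v u
| congr_trans u v w : congr_gen u v -> congr_gen v w -> congr_gen u w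
| congr_cat u u' v v' :
    congr_gen u u' -> congr_gen v v' -> congr_gen (u ++ v) (u' ++ v').

End Rewriting.

Section PresentedMonoid.
Variables (A : choiceType) (T : rewriting_system A).

Definition congr_genb : rel (seq A) := fun u v => `[< congr_gen T u v >].

Fact congr_genb_refl : reflexive congr_genb.
Proof. by move=> u; apply/asboolP; exact: congr_refl. Qed.

Fact congr_genb_sym : symmetric congr_genb.
Proof.
by move=> u v; apply/asboolP/asboolP; exact: congr_sym.
Qed.

Fact congr_genb_trans : transitive congr_genb.
Proof.
by move=> v u w /asboolP uv /asboolP vw; apply/asboolP; exact: congr_trans vw.
Qed.

Canonical congr_equiv :=
  EquivRel congr_genb congr_genb_refl congr_genb_sym congr_genb_trans.

(* The monoid < A | T >: the quotient of the free monoid by congr_gen T. *)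
Definition presented := {eq_quot congr_equiv}%qT.
HB.instance Definition _ := Choice.on presented.

Definition word_class (w : seq A) : presented := (\pi_({eq_quot congr_equiv}) w)%qT.

Lemma word_classP u v : word_class u = word_class v <-> congr_gen T u v.
Proof.
split=> [/eqP|uv]; first by rewrite /word_class (eqmodE congr_equiv) => /asboolP.
by apply/eqP; rewrite /word_class (eqmodE congr_equiv); apply/asboolP.
Qed.

Definition word_repr (x : presented) : seq A := repr (x : {eq_quot congr_equiv}%qT).

Lemma word_reprK : cancel word_repr word_class.
Proof. by move=> x; exact: reprK. Qed.

Definition presented_one : presented := word_class [::].

Definition presented_mul (x y : presented) : presented :=
  word_class (word_repr x ++ word_repr y).

Lemma word_class_cat u v :
  word_class (u ++ v) = presented_mul (word_class u) (word_class v).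
Proof.
apply/word_classP; apply: congr_cat; apply: congr_sym;
  by apply/word_classP; rewrite word_reprK.
Qed.

Fact presented_mulA : associative presented_mul.
Proof.
move=> x y z; rewrite -(word_reprK x) -(word_reprK y) -(word_reprK z).
by rewrite -!word_class_cat catA.
Qed.

Fact presented_mul1 : left_id presented_one presented_mul.
Proof. by move=> x; rewrite -(word_reprK x) -word_class_cat. Qed.

Fact presented_mulr1 : right_id presented_one presented_mul.
Proof. by move=> x; rewrite -(word_reprK x) -word_class_cat cats0. Qed.

HB.instance Definition _ := isMonoid.Build presented
  presented_mulA presented_mul1 presented_mulr1.

End PresentedMonoid.

(* T presents the monoid M on the generators g: the quotient of A^* by
   congr_gen T is M, the class of each letter a being the generator g a. *)
Definition presents (A : choiceType) (T : rewriting_system A)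
    (M : monoidType) (g : A -> M) : Prop :=
  exists phi : presented T -> M,
    [/\ monoid_morphism phi, bijective phi
      & forall a, phi (word_class T [:: a]) = g a].

Section Hypoplactic.
Variable n : nat.

(* 'I_n, with its order as naturals, stands for {1 < ... < n}. *)
Implicit Types (a b c d : 'I_n) (u v w : seq 'I_n).

Definition hypo_R : rewriting_system 'I_n :=
  [set p | exists a b c,
     a <= b < c /\ p = ([:: a; c; b], [:: c; a; b])] `|`
  [set p | exists a b c,
     a < b <= c /\ p = ([:: b; a; c], [:: b; c; a])].

Definition hypo_S : rewriting_system 'I_n :=
  [set p | exists a b c d,
     [/\ a <= b, b < c, c <= d & p = ([:: c; a; d; b], [:: a; c; b; d])]] `|`
  [set p | exists a b c d,
     [/\ a < b, b <= c, c < d & p = ([:: b; d; a; c], [:: d; b; c; a])]].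

Definition hypoplactic : monoidType := presented (hypo_R `|` hypo_S).

Definition hypo_class w : hypoplactic := word_class (hypo_R `|` hypo_S) w.

Definition column u : bool := sorted (fun a b => b < a) u.

(* A product of columns has columns of maximal length when no two consecutive
   factors concatenate to a column. *)
Definition column_decomposition w (cs : seq (seq 'I_n)) : Prop :=
  [/\ w = flatten cs,
      all (fun u => (u != [::]) && column u) cs
    & sorted (fun u v => ~~ column (u ++ v)) cs].

Definition head_le_last u v : bool :=
  match u, v with
  | a :: _, b :: v' => a <= last b v'
  | _, _ => true
  end.

Definition quasi_ribbon w : Prop :=
  exists2 cs, column_decomposition w cs & sorted head_le_last cs.

(* The quasi-ribbon word representing the same element as w; the default value
   w of xget is never reached, by Novelli's cross-section theorem. *)
Definition Q w : seq 'I_n :=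
  xget w [set q | quasi_ribbon q /\ hypo_class q = hypo_class w].

Definition hypo_system : rewriting_system 'I_n :=
  [set p | exists w,
     [/\ w <> Q w, size w <= maxn (2 * n) 4 & p = (w, Q w)]].

End Hypoplactic.

Arguments hypo_R n : clear implicits.
Arguments hypo_S n : clear implicits.
Arguments hypo_system n : clear implicits.

(* Main.v *)
From Stdlib Require Import Setoid Morphisms Relation_Operators.
Require Import Defs.
From mathcomp Require Import all_boot.
From mathcomp Require Import zify.
From mathcomp Require Import boolp classical_sets cardinality.

(** The class of a word in the hypoplactic monoid is determined by how often
each letter occurs and, for each pair a < b of letters that are neighbours in
the support of the word, by whether some b stands to the left of some a.  The
relations respect these data ([hypo_same_inversions]).  A quasi-ribbon word is
determined by them: its letters increase weakly from one column to the next, so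
a letter b stands before a smaller a exactly when both lie in one column, and
for a and b that are not neighbours this is the case exactly when every
intermediate letter that occurs does so once and is inverted with both of them.
So the data for neighbouring letters give the data for all pairs, hence all
projections of the word to two letters, and these determine the word
([quasi_ribbon_unique]).

In the other direction, the relations allow two adjacent letters c a with a < c
to be exchanged as soon as a letter b with a < b <= c stands anywhere to the
left of them, or one with a <= b < c anywhere to the right ([swap_after_far]
and [swap_before_far]).  In a word that is not a quasi-ribbon word, two
consecutive columns violate the defining inequality, and then one of them has a
descent c a to which this applies, with b in the other column.  The exchange
lowers the number of inversions, that is, of pairs of positions whose letters
decrease, and everything happens inside a factor of length at most 2n, because
a column has at most n letters ([quasi_ribbon_or_reducible]).

The theorem follows.  By descent on the number of inversions each class
contains a quasi-ribbon word, only one by the first paragraph, and it has fewer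
inversions than every other word of the class.  The number of inversions of a
word with a factor replaced by a permutation of itself changes by as much as
that of the factor, so every rewriting step lowers it and the system is
noetherian.  A word that is not a quasi-ribbon word has a factor of length at
most 2n that is not the best in its class, so a rule applies to it; every word
u thus rewrites to [Q u], which depends only on the class of u.  This gives
confluence and shows that the rules generate the hypoplactic congruence. *)

Set Implicit Arguments.
Unset Strict Implicit.
Unset Printing Implicit Defensive.

(** * Sequences and their projections to two letters *)

Lemma split_last_has (T : Type) (P : pred T) (s : seq T) : has P s ->
  exists s1 x s2, [/\ s = s1 ++ x :: s2, P x & ~~ has P s2].
Proof.
elim: s => //= x s IH; have [/IH[s1 [y [s2 [-> Py s2P]]]] _ | sP] := boolP (has P s).
  by exists (x :: s1), y, s2.
by rewrite orbF => Px; exists [::], x, s.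
Qed.

Lemma not_sorted_split (T : Type) (r : rel T) s : ~~ sorted r s ->
  exists s1 x y s2, s = s1 ++ [:: x, y & s2] /\ ~~ r x y.
Proof.
elim: s => // x [|y s] // IH; rewrite [sorted _ _]/= negb_and.
case/orP=> [xy | /IH[s1 [u [v [s2 [E uv]]]]]]; first by exists [::], x, y, s.
by exists (x :: s1), u, v, s2; rewrite E.
Qed.

Lemma adjacent_crossing (T : Type) (P : pred T) x s : P x -> ~~ P (last x s) ->
  exists s1 c a s2, [/\ x :: s = s1 ++ [:: c, a & s2], P c & ~~ P a].
Proof.
elim: s x => [|y s IH] x /=; first by move=> ->.
move=> Px nP; have [Py|nPy] := boolP (P y); last by exists [::], x, y, s.
have [s1 [c [a [s2 [-> Pc Pa]]]]] := IH y Py nP.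
by exists (x :: s1), c, a, s2.
Qed.

Section Subwords.
Variable T : eqType.
Implicit Types (a b c x : T) (u v w : seq T).

Definition precedes b a w := subseq [:: b; a] w.

Lemma precedes_cons b a x w :
  precedes b a (x :: w) = (b == x) && (a \in w) || precedes b a w.
Proof.
rewrite /precedes [subseq _ (x :: w)]/=; case: eqP => //= _; rewrite sub1seq.
case: (boolP (a \in w)) => //= aw; apply/esym/negP => /mem_subseq/(_ a).
by rewrite !inE eqxx orbT (negPf aw) => /(_ isT).
Qed.

Lemma precedes_cat b a u v : precedes b a (u ++ v) =
  [|| precedes b a u, (b \in u) && (a \in v) | precedes b a v].
Proof.
elim: u => //= x u IH; rewrite !precedes_cons IH inE mem_cat.
case: (b == x); case: (a \in u); case: (a \in v);
  by rewrite /= ?orbT ?orbF ?andbF ?andbT.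
Qed.

Lemma precedes_mem b a w : precedes b a w -> b \in w /\ a \in w.
Proof. by move=> /mem_subseq ba; split; apply: ba; rewrite !inE eqxx ?orbT. Qed.

Lemma precedes_trans_uniq b c a w : count_mem c w = 1 ->
  precedes b c w -> precedes c a w -> precedes b a w.
Proof.
move=> c1 bc ca; have [_ cw] := precedes_mem bc.
case/splitPr: cw c1 bc ca => u v; rewrite count_cat /= eqxx => c1.
have cu : c \notin u by apply/count_memPn; lia.
have cv : c \notin v by apply/count_memPn; lia.
have notin s x y : c \in [:: x; y] -> c \notin s -> precedes x y s = false.
  rewrite !inE => /orP[]/eqP <- cs; apply/negP => /precedes_mem[];
    by rewrite (negPf cs).
rewrite !precedes_cat !precedes_cons !inE (negPf cv) !andbF eqxx.
rewrite (notin u b c) ?(notin u c a) ?(notin v b c) ?(notin v c a);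
  rewrite ?inE ?eqxx ?orbT //=.
by rewrite (negPf cu) andbT !orbF => -> /= ->; rewrite !orbT.
Qed.

(** Where two words first differ, with letters x and y, their projections to
{x, y} differ too.  The case a = b compares numbers of occurrences, which
serves words with a single letter. *)
Lemma eq_from_pair_projections u v :
    (forall a b, filter (pred2 a b) u = filter (pred2 a b) v) -> u = v.
Proof.
elim: u v => [|x u IH] [|y v] uv //.
- by have := uv y y; rewrite /= eqxx.
- by have := uv x x; rewrite /= eqxx.
have xy : x = y by have := uv x y; rewrite /= !eqxx orbT => -[].
rewrite -xy in uv *; congr cons; apply: IH => a b.
by have := uv a b; rewrite /=; case: ifP => // _ [].
Qed.

Lemma pair_projection_sorted a b w : a != b -> ~~ precedes b a w ->
  filter (pred2 a b) w = nseq (count_mem a w) a ++ nseq (count_mem b w) b.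
Proof.
move=> ab; elim: w => //= x w IH; rewrite precedes_cons negb_or => /andP[bx].
move=> /IH ->{IH}; move: bx; rewrite [x == b]eq_sym.
have [<-{x} | bx] := eqVneq b x; last by case: eqP => // ->.
by rewrite eq_sym (negPf ab) /= => /count_memPn ->.
Qed.

End Subwords.

(** * Monoids presented by systems that generate the same congruence *)

Lemma same_congr_map (A : choiceType) (T U : rewriting_system A) :
    (forall u v, congr_gen T u v -> congr_gen U u v) ->
  exists phi : presented T -> presented U,
    forall u, phi (word_class T u) = word_class U u.
Proof.
move=> TU; exists (fun x => word_class U (word_repr x)) => u.
by apply/word_classP/TU/word_classP; rewrite word_reprK.
Qed.

Lemma same_congr_presents (A : choiceType) (T U : rewriting_system A) :
    (forall u v, congr_gen T u v <-> congr_gen U u v) ->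
  presents T (fun a => word_class U [:: a] : presented U).
Proof.
move=> TU; have [phi phiE] : exists phi : presented T -> presented U,
    forall u, phi (word_class T u) = word_class U u.
  by apply: same_congr_map => u v /TU.
have [psi psiE] : exists psi : presented U -> presented T,
    forall u, psi (word_class U u) = word_class T u.
  by apply: same_congr_map => u v /TU.
exists phi; split=> [||a]; last exact: phiE.
- split=> [|x y]; first exact: phiE.
  rewrite -(word_reprK x) -(word_reprK y).
  move: (word_repr x) (word_repr y) => u v.
  have -> : (word_class T u * word_class T v)%g = word_class T (u ++ v).
    by rewrite word_class_cat.
  by rewrite !phiE word_class_cat.
- by exists psi => x; rewrite -(word_reprK x); rewrite !(phiE, psiE).
Qed.

(** * The hypoplactic congruence and its symmetry *)

Section HypoplacticCongruence.
Variable n : nat.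
Implicit Types (a b c d e m p q x y : 'I_n) (u v w z t : seq 'I_n).

Definition hypo_equiv u v : Prop := congr_gen (hypo_R n `|` hypo_S n)%classic u v.

Local Notation "u ≡ v" := (hypo_equiv u v) (at level 70).

Instance hypo_equiv_Equivalence : Equivalence hypo_equiv.
Proof.
by split; [exact: congr_refl | exact: congr_sym | exact: congr_trans].
Qed.

#[local] Hint Extern 0 (_ ≡ _) => reflexivity : core.

Instance hypo_equiv_cat :
  Proper (hypo_equiv ==> hypo_equiv ==> hypo_equiv) (@cat 'I_n).
Proof. by move=> u u' uu' v v' vv'; exact: congr_cat. Qed.

Instance hypo_equiv_cons x : Proper (hypo_equiv ==> hypo_equiv) (cons x).
Proof. by move=> u v uv; apply: (congr_cat (congr_refl _ [:: x]) uv). Qed.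

Lemma rule_equiv l r t :
  (hypo_R n `|` hypo_S n)%classic (l, r) -> l ++ t ≡ r ++ t.
Proof. by move=> lr; apply: congr_cat; [exact: congr_rule | exact: congr_refl]. Qed.

(** The four families of defining relations, oriented towards the side with
fewer inversions, with a tail t that lets them rewrite inside longer words. *)
Lemma swap_before a b c t :
  a <= b -> b < c -> [:: c, a, b & t] ≡ [:: a, c, b & t].
Proof.
move=> ab bc; symmetry; apply: (@rule_equiv [:: a; c; b] [:: c; a; b]).
by left; left; exists a, b, c; rewrite ab bc.
Qed.

Lemma swap_after a b c t :
  a < b -> b <= c -> [:: b, c, a & t] ≡ [:: b, a, c & t].
Proof.
move=> ab bc; symmetry; apply: (@rule_equiv [:: b; a; c] [:: b; c; a]).
by left; right; exists a, b, c; rewrite ab bc.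
Qed.

Lemma double_swap_in a b c d t : a <= b -> b < c -> c <= d ->
  [:: c, a, d, b & t] ≡ [:: a, c, b, d & t].
Proof.
move=> ab bc cd; apply: (@rule_equiv [:: c; a; d; b] [:: a; c; b; d]).
by right; left; exists a, b, c, d; split.
Qed.

Lemma double_swap_out a b c d t : a < b -> b <= c -> c < d ->
  [:: d, b, c, a & t] ≡ [:: b, d, a, c & t].
Proof.
move=> ab bc cd; symmetry.
apply: (@rule_equiv [:: b; d; a; c] [:: d; b; c; a]).
by right; right; exists a, b, c, d; split.
Qed.

Definition flip w := rev (map (@rev_ord n) w).

Lemma flip_cat u v : flip (u ++ v) = flip v ++ flip u.
Proof. by rewrite /flip map_cat rev_cat. Qed.

Lemma flipK : involutive flip.
Proof.
move=> w; rewrite /flip map_rev revK -map_comp -[RHS]map_id.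
by apply: eq_map => x /=; rewrite rev_ordK.
Qed.

(** [flip] exchanges the two families of R and maps each family of S
to itself. It turns the exchange of a descent c a because of a letter on its
left into one because of a letter on its right, so only the former needs a
proof. *)
Lemma flip_equiv u v : u ≡ v -> flip u ≡ flip v.
Proof.
have le_rev x y : x <= y -> rev_ord y <= rev_ord x by move=> /=; lia.
have lt_rev x y : x < y -> rev_ord y < rev_ord x.
  by move=> /=; have := ltn_ord y; lia.
elim=> {u v} [l r | u | u v _ | u v w _ uv _ | u u' v v' _ uu' _ vv'].
- case=> -[] [a [b [c]]].
  + move=> [/andP[/le_rev ab /lt_rev bc] [-> ->]].
    rewrite /flip /rev /=; symmetry; exact: swap_after.
  + move=> [/andP[/lt_rev ab /le_rev bc] [-> ->]].
    rewrite /flip /rev /=; symmetry; exact: swap_before.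
  + move=> [d [/le_rev ab /lt_rev bc /le_rev cd [-> ->]]].
    rewrite /flip /rev /=; exact: double_swap_in.
  + move=> [d [/lt_rev ab /le_rev bc /lt_rev cd [-> ->]]].
    rewrite /flip /rev /=; symmetry; exact: double_swap_out.
- by [].
- by symmetry.
- by move=> vw; transitivity (flip v).
- by rewrite !flip_cat uu' vv'.
Qed.

(** The bound k serves the induction on the distance between a descent and the
letter that allows its exchange. *)
Definition swaps_after k := forall a b c z t, size z < k -> a < b -> b <= c ->
  b :: z ++ [:: c, a & t] ≡ b :: z ++ [:: a, c & t].

Definition swaps_before k := forall a b c z t, size z < k -> a <= b -> b < c ->
  [:: c, a & z ++ b :: t] ≡ [:: a, c & z ++ b :: t].

Lemma swaps_before_of_after k : swaps_after k -> swaps_before k.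
Proof.
move=> swapk a b c z t zk ab bc.
have fl x y : flip [:: x, y & z ++ b :: t] =
    flip t ++ rev_ord b :: flip z ++ [:: rev_ord y; rev_ord x].
  by rewrite -cat1s -[y :: _]cat1s -[b :: _]cat1s !flip_cat -!catA.
rewrite -[X in X ≡ _]flipK -[X in _ ≡ X]flipK; apply: flip_equiv.
rewrite !fl swapk //=; first by rewrite /flip size_rev size_map.
  by have := ltn_ord b; have := ltn_ord c; lia.
by have := ltn_ord b; have := ltn_ord c; lia.
Qed.

(** * Exchanging a descent because of a distant letter *)

(** The induction step from [swaps_after k] to [swaps_after k.+1]. The letters
a < b <= c are fixed and [crosses z] says that b acts on the descent c a across
the block z, which has at most k letters. *)
Section Swap.
Variables (a b c : 'I_n) (k : nat).
Hypotheses (ab : a < b) (bc : b <= c) (after : swaps_after k).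

Let before : swaps_before k := swaps_before_of_after after.

Definition crosses z :=
  forall t, b :: z ++ [:: c, a & t] ≡ b :: z ++ [:: a, c & t].

(** A letter m of the block with a < m <= c can replace b, and it is closer. *)
Lemma crosses_pivot u m v : size v < k -> a < m -> m <= c ->
  crosses (u ++ m :: v).
Proof. by move=> vk am mc t; rewrite -!catA !cat_cons after. Qed.

(** If b can be moved past the first letter of the block, with anything after
the block, then b comes closer, acts, and moves back. *)
Lemma crosses_first p z : size z < k ->
    (forall t, [:: b, p & z ++ t] ≡ [:: p, b & z ++ t]) ->
  crosses (p :: z).
Proof. by move=> zk bp t; rewrite /= !bp after. Qed.

(** A last letter q <= a passes c because of a, and it passes a because of m
in the block. Moving it past both leaves the shorter block z, across which c and
a are exchanged; then q returns for the same reasons. *)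
Lemma crosses_last_low z q m : size z < k -> m \in z -> q < m -> m <= a ->
  crosses (rcons z q).
Proof.
move=> zk zm qm ma t; rewrite !cat_rcons.
case/splitPr: zm zk => u v zk.
have zE r :
    b :: u ++ m :: v ++ [:: c, a & r] ≡ b :: u ++ m :: v ++ [:: a, c & r].
  by have := after r zk ab bc; rewrite -!catA.
rewrite size_cat /= in zk; rewrite -!catA !cat_cons.
have vE r : m :: v ++ [:: a, q & r] ≡ m :: v ++ [:: q, a & r].
  by apply: after; lia.
have vcE r : m :: v ++ [:: c, a, q & r] ≡ m :: v ++ [:: c, q, a & r].
  by rewrite -!(cat_rcons c); apply: after; rewrite ?size_rcons; lia.
rewrite -(@swap_before q a c); [|lia..].
rewrite -vcE zE (@swap_after q a c); [|lia..].
by rewrite vE.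
Qed.

(** As for [crosses_last_low], with the roles of a and c exchanged: now m is
what lets q pass c, and c is what lets q pass a. *)
Lemma crosses_last_high z q m : size z < k -> m \in z -> c < m -> m <= q ->
  crosses (rcons z q).
Proof.
move=> zk zm cm mq t; rewrite !cat_rcons.
case/splitPr: zm zk => u v zk.
have zE r :
    b :: u ++ m :: v ++ [:: c, a & r] ≡ b :: u ++ m :: v ++ [:: a, c & r].
  by have := after r zk ab bc; rewrite -!catA.
rewrite size_cat /= in zk; rewrite -!catA !cat_cons.
have vE r : m :: v ++ [:: q, c & r] ≡ m :: v ++ [:: c, q & r].
  by apply: after; lia.
have vaE r : m :: v ++ [:: a, q, c & r] ≡ m :: v ++ [:: a, c, q & r].
  by rewrite -!(cat_rcons a); apply: after; rewrite ?size_rcons; lia.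
rewrite vE (@swap_after a c q); [|lia..].
by rewrite zE -vaE -(@swap_before a c q) //; lia.
Qed.

Lemma crosses_first_low z p m : size z < k -> m \in z -> p <= m -> m < b ->
  crosses (p :: z).
Proof.
move=> zk zm pm mb; apply: crosses_first => // t.
case/splitPr: zm zk => u v; rewrite size_cat /= => zk.
by rewrite -!catA !cat_cons before //; lia.
Qed.

Lemma crosses_first_high z p m : size z < k -> m \in z -> b <= m -> m < p ->
  crosses (p :: z).
Proof.
move=> zk zm bm mp; apply: crosses_first => // t.
case/splitPr: zm zk => u v; rewrite size_cat /= => zk.
by rewrite -!catA !cat_cons -before //; lia.
Qed.

(** The letters of the block that do not lie in the interval ]a, c] are either
low, at most a, or high, above c. If the first and the last are on the same
side, then, depending on how they compare, either the last lets b pass the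
first, or the first is the letter m of the two lemmas on the last letter. *)
Lemma crosses_same_side p z q : size z < k.-1 ->
    (p <= a) && (q <= a) || (c < p) && (c < q) ->
  crosses (p :: rcons z q).
Proof.
move=> zk; have sz : size (rcons z q) < k by rewrite size_rcons; lia.
have [zq zp] : q \in rcons z q /\ p \in p :: z.
  by rewrite mem_rcons !mem_head.
case/orP=> /andP[hp hq]; have [pq | qp] := leqP p q.
- by apply: (crosses_first_low sz zq) => //; lia.
- by rewrite -rcons_cons; apply: (crosses_last_low _ zp) => //=; lia.
- by rewrite -rcons_cons; apply: (crosses_last_high _ zp) => //=; lia.
- by apply: (crosses_first_high sz zq) => //; lia.
Qed.

Definition opposite x y := ((x <= a) && (c < y)) || ((y <= a) && (c < x)).

(** Inside the block a low and a high letter that are adjacent can be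
exchanged, because c follows the block both before and after the exchange of c
and a. *)
Lemma crosses_shuffle1 z1 x y z2 : size (z1 ++ [:: x, y & z2]) <= k ->
    opposite x y -> crosses (z1 ++ [:: x, y & z2]) ->
  crosses (z1 ++ [:: y, x & z2]).
Proof.
rewrite size_cat /= => zk xy cr t; have {cr}:= cr t.
have sw r : [:: x, y & z2 ++ c :: r] ≡ [:: y, x & z2 ++ c :: r].
  by case/orP: xy => xy; [symmetry|]; apply: before; lia.
have swa r : [:: x, y & z2 ++ [:: a, c & r]] ≡ [:: y, x & z2 ++ [:: a, c & r]].
  rewrite -!(cat_rcons a).
  by case/orP: xy => xy; [symmetry|]; apply: before; rewrite ?size_rcons; lia.
by rewrite -!catA !cat_cons sw swa.
Qed.

Lemma crosses_shuffle z1 x s z2 : size (z1 ++ x :: s ++ z2) <= k ->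
    all (opposite x) s -> crosses (z1 ++ s ++ x :: z2) ->
  crosses (z1 ++ x :: s ++ z2).
Proof.
elim: s z1 => [|y s IH] z1 //= zk /andP[xy xs] cr.
apply: crosses_shuffle1; first by move: zk; rewrite !size_cat /=.
  by move: xy; rewrite /opposite orbC.
rewrite -cat_rcons; apply: IH => //; last by rewrite cat_rcons.
by move: zk; rewrite !size_cat size_rcons /= size_cat; lia.
Qed.

(** The block with one low and one high letter cannot be given equal sides by
a shuffle, so it needs a chain of its own: b e d c a is led through
d b e c a, d e b a c, e d b a c, e b d a c to b e d a c. *)
Lemma crosses_low_high e d : 1 < k -> e <= a -> c < d -> crosses [:: e; d].
Proof.
move=> k1 ea cd t /=.
have ed r : [:: b, d, e, c & r] ≡ [:: d, b, e, c & r].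
  by symmetry; apply: (@before b c d [:: e]) => //; lia.
have be r : [:: b, e, d, a & r] ≡ [:: e, b, d, a & r].
  by apply: (@before e a b [:: d]) => //; lia.
rewrite -(@swap_after e b d) ?ed; [|lia..].
rewrite (@double_swap_in e a b c) // (@swap_before e b d); [|lia..].
rewrite -(@swap_after a b c) // (@double_swap_out a b c d) //.
by rewrite be.
Qed.

(** A block of at least three letters, all low or high, can be shuffled until
its first and last letters are on the same side. *)
Lemma crosses_all z : size z <= k -> crosses z.
Proof.
have [|z_sides] := boolP (has (fun m => (a < m) && (m <= c)) z).
  move=> /hasP[m /splitPr[u v] /andP[am mc]] zk.
  by apply: crosses_pivot => //; move: zk; rewrite size_cat /=; lia.
have side m : m \in z -> (m <= a) || (c < m).
  by move=> mz; have := hasPn z_sides m mz; lia.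
case: z {z_sides} side => [|p z] side zk; first by move=> t; exact: swap_after.
case/lastP: z => [|z q] in side zk *.
  move=> t /=; have /orP[pa|cp] := side p (mem_head _ _).
    rewrite (@double_swap_in p a b c) //.
    by rewrite (@swap_before p a b).
  by rewrite -(@swap_before b c p) // (@double_swap_out a b c p).
rewrite /= size_rcons in zk.
have sideR m : m \in z -> (m <= a) || (c < m).
  by move=> mz; rewrite side // inE mem_rcons inE mz !orbT.
have sq : (q <= a) || (c < q) by rewrite side // inE mem_rcons mem_head orbT.
have sp : (p <= a) || (c < p) by rewrite side ?mem_head.
have [same | diff] := boolP ((p <= a) && (q <= a) || (c < p) && (c < q)).
  by apply: crosses_same_side => //; lia.
have pq : opposite p q by rewrite /opposite; lia.
case zE: z => [|m z'].
  case/orP: pq => /andP[ea cd]; first by apply: crosses_low_high => //; lia.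
  apply: (@crosses_shuffle1 [::]); rewrite /opposite ?cd ?ea //=; first lia.
  by apply: crosses_low_high => //; lia.
(* If some letter between p and q is on the side of p, the last such letter h
   can be moved to the end of the block: what follows it is opposite to it. *)
have [/split_last_has[s1 [h [s2 [zE' hp s2p]]]] | zp] :=
  boolP (has (fun h => ~~ opposite p h) z).
  have sh : (h <= a) || (c < h) by apply: sideR; rewrite zE' mem_cat mem_head orbT.
  rewrite -zE zE' rcons_cat rcons_cons -cat_cons -[rcons s2 q]cats0.
  apply: crosses_shuffle.
  - by move: zk; rewrite zE' !size_cat /= size_cat size_rcons /=; lia.
  - rewrite all_rcons; apply/andP; split.
      by move: hp pq; rewrite /opposite; lia.
    apply/allP => x xs; have := hasPn s2p x xs.
    by move: hp pq; rewrite /opposite; lia.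
  rewrite cats1 -rcons_cat; apply: crosses_same_side.
    by move: zk; rewrite zE' !size_cat /= size_rcons; lia.
  by move: hp sp sh; rewrite /opposite; lia.
(* Otherwise all of them are on the side of q, and the exchange of p with the
   letter m after it makes m the first letter of the block. *)
have pm : opposite p m by have := hasPn zp m; rewrite zE mem_head negbK; apply.
apply: (@crosses_shuffle1 [::]); first by rewrite /= size_rcons -/(size (m :: z')) -zE.
  by move: pm; rewrite /opposite orbC.
rewrite /= -rcons_cons; apply: crosses_same_side.
  by move: zk; rewrite zE /=; lia.
by move: pq pm; rewrite /opposite; lia.
Qed.

End Swap.

Lemma swaps_after_all k : swaps_after k.
Proof.
elim: k => // k IH a b c z t zk ab bc.
by apply: crosses_all IH _ _ _.
Qed.

Lemma swap_after_far a b c z t : a < b -> b <= c ->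
  b :: z ++ [:: c, a & t] ≡ b :: z ++ [:: a, c & t].
Proof. exact: (@swaps_after_all (size z).+1). Qed.

Lemma swap_before_far a b c z t : a <= b -> b < c ->
  [:: c, a & z ++ b :: t] ≡ [:: a, c & z ++ b :: t].
Proof. exact: (swaps_before_of_after (@swaps_after_all (size z).+1)). Qed.

(** * Invariants of the hypoplactic congruence *)

(** The pair b, a is compared only when no letter strictly between a and b
occurs: the defining relations do change other pairs. *)
Definition same_inversions u v : Prop :=
  perm_eq u v /\
  forall a b, a < b -> (forall c, c \in u -> ~~ (a < c < b)) ->
    precedes b a u = precedes b a v.

Lemma same_inversions_sym u v : same_inversions u v -> same_inversions v u.
Proof.
move=> [uv inv]; split=> [|a b ab no]; first by rewrite perm_sym.
by rewrite inv // => c; rewrite (perm_mem uv); exact: no.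
Qed.

(** [same_inversions] is compatible with concatenation: if no letter of u ++ v
lies between a and b, then none of u or of v does, and b precedes a in u ++ v
if it does in u or in v, or if b occurs in u and a in v. So it is enough to
check the defining relations, whose exchanged letters either have a letter of
the relation strictly between them or keep an inversion because one of them
occurs twice. *)
Lemma hypo_same_inversions u v : u ≡ v -> same_inversions u v.
Proof.
have rule l r : perm_eq l r ->
    (forall a b, a < b -> all (fun c => ~~ (a < c < b)) l ->
      precedes b a l = precedes b a r) -> same_inversions l r.
  by move=> lr inv; split=> // a b ab no; apply: inv => //; apply/allP.
elim=> {u v} [l r | u | u v _ | u v w _ uv _ | u u' v v' _ uu' _ vv'].
- case=> -[] [a [b [c]]].
  + move=> [/andP[ab bc] [-> ->]]; apply: rule => [|x y xy].
      by rewrite -[[:: a; c; b]]/([:: a] ++ [:: c] ++ [:: b]) perm_catCA.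
    by rewrite /= !precedes_cons !inE -!val_eqE /=; lia.
  + move=> [/andP[ab bc] [-> ->]]; apply: rule => [|x y xy].
      by rewrite perm_cons -[[:: a; c]]/([:: a] ++ [:: c]) perm_catC.
    by rewrite /= !precedes_cons !inE -!val_eqE /=; lia.
  + move=> [d [ab bc cd [-> ->]]]; apply: rule => [|x y xy].
      apply/permP => P /=; lia.
    by rewrite /= !precedes_cons !inE -!val_eqE /=; lia.
  + move=> [d [ab bc cd [-> ->]]]; apply: rule => [|x y xy].
      apply/permP => P /=; lia.
    by rewrite /= !precedes_cons !inE -!val_eqE /=; lia.
- by [].
- exact: same_inversions_sym.
- move=> [vw ivw]; case: uv => [uv iuv]; split; first exact: perm_trans vw.
  move=> a b ab no; rewrite iuv // ivw // => c; rewrite -(perm_mem uv); exact: no.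
- case: uu' vv' => [uu' iu] [vv' iv]; split; first exact: perm_cat.
  move=> a b ab no; rewrite !precedes_cat (perm_mem uu') (perm_mem vv') iu ?iv //.
    by move=> c cv; apply: no; rewrite mem_cat cv orbT.
  by move=> c cu; apply: no; rewrite mem_cat cu.
Qed.

(** * Columns and inversions of quasi-ribbon words *)

Lemma gt_trans : transitive (fun a b : 'I_n => b < a).
Proof. by move=> b a c /[swap]; exact: ltn_trans. Qed.

Lemma column_catr u v : column (u ++ v) -> column v.
Proof. by move=> /cat_sorted2[]. Qed.

Lemma column_le_head a u x : column (a :: u) -> x \in a :: u -> x <= a.
Proof.
rewrite inE => au /predU1P[-> // | xu].
by have /allP/(_ x xu)/ltnW := order_path_min gt_trans au.
Qed.

Lemma column_ge_last a u x : column (a :: u) -> x \in a :: u -> last a u <= x.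
Proof.
elim: u a x => [|b u IH] a x /=; first by rewrite inE => _ /eqP ->.
move=> /andP[ba bu]; rewrite inE => /predU1P[-> | xbu].
  by apply: leq_trans _ (ltnW ba); apply: (IH b); rewrite ?mem_head.
exact: (IH b).
Qed.

Lemma column_uniq u : column u -> uniq u.
Proof. by apply: sorted_uniq; [exact: gt_trans | move=> a /=; rewrite ltnn]. Qed.

Lemma column_size u : column u -> size u <= n.
Proof.
by move=> /column_uniq/card_uniqP <-; rewrite -[leqRHS]card_ord max_card.
Qed.

Lemma column_precedes b a u : column u -> a < b -> b \in u -> a \in u ->
  precedes b a u.
Proof.
move=> cu ab bu; case/splitPr: bu cu => v w cu.
rewrite mem_cat precedes_cat precedes_cons eqxx /=.
case/orP=> [av | ]; last first.
  by rewrite inE => /predU1P[ab' | ->]; [rewrite ab' ltnn in ab | rewrite !orbT].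
move: cu; case/splitPr: av => v1 v2.
rewrite -catA => /column_catr /= /(order_path_min gt_trans)/allP/(_ b).
by rewrite mem_cat mem_head orbT => /(_ isT); lia.
Qed.

(** Consecutive columns compare by their extreme letters only; as the columns
are nonempty, this comparison passes through all the later ones. *)
Lemma columns_increasing u cs : path (@head_le_last n) u cs -> column u ->
    all (fun v => (v != [::]) && column v) cs ->
  forall x y, x \in u -> y \in flatten cs -> x <= y.
Proof.
elim: cs u => [|v cs IH] u //= /andP[uv vcs] cu /andP[/andP[v0 cv] ccs] x y xu.
case: u v => [|a u] [|b v] // in v0 cv uv vcs cu xu *.
have xb : x <= last b v by apply: leq_trans (column_le_head cu xu) uv.
rewrite mem_cat => /orP[yv | ycs].
  by apply: leq_trans xb _; exact: column_ge_last.
by apply: leq_trans xb _; apply: (IH (b :: v)) => //; exact: mem_last.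
Qed.

(** Letters of different columns are never inverted, so an inverted pair lies in
one column v, and the column inequalities confine the letters around it. *)
Lemma inversion_in_column b a w : quasi_ribbon w -> a < b -> precedes b a w ->
  exists u v z, [/\ w = u ++ v ++ z, column v, precedes b a v,
    forall x, x \in u -> x <= a & forall x, x \in z -> b <= x].
Proof.
case=> cs [-> {w} ccs _] rib ab; elim: cs ccs rib => // v cs IH /=.
move=> /andP[/andP[_ cv] ccs] rib; have inc := columns_increasing rib cv ccs.
rewrite precedes_cat => /or3P[ba | /andP[bv acs] | ba].
- exists [::], v, (flatten cs); split=> // x xz; apply: inc xz.
  by have [] := precedes_mem ba.
- by have := inc b a bv acs; lia.
have [u [v' [z [csE cv' bav' ua bz]]]] := IH ccs (path_sorted rib) ba.
exists (v ++ u), v', z; split=> //; first by rewrite csE catA.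
move=> x; rewrite mem_cat => /orP[xv|]; last exact: ua.
by apply: inc xv _; have [_] := precedes_mem ba.
Qed.

Lemma inversion_interpolates b a c w : quasi_ribbon w -> a < c < b ->
    precedes b a w -> c \in w ->
  [/\ count_mem c w = 1, precedes b c w & precedes c a w].
Proof.
move=> rib /andP[ac cb] ba.
have [u [v [z [-> cv /precedes_mem[bv av] ua bz]]]] :=
  inversion_in_column rib (ltn_trans ac cb) ba.
have cu : c \notin u by apply/negP => /ua; lia.
have cz : c \notin z by apply/negP => /bz; lia.
rewrite !mem_cat (negPf cu) (negPf cz) orbF /= => cin.
split; last 2 first.
- by rewrite !precedes_cat (column_precedes cv cb) // !orbT.
- by rewrite !precedes_cat (column_precedes cv ac) // !orbT.
rewrite !count_cat (count_memPn cu) (count_memPn cz) addn0.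
by rewrite count_uniq_mem ?cin // column_uniq.
Qed.

Lemma pair_projection_inverted b a w : quasi_ribbon w -> a < b ->
    precedes b a w ->
  filter (pred2 a b) w =
    nseq (count_mem a w).-1 a ++ [:: b; a] ++ nseq (count_mem b w).-1 b.
Proof.
move=> rib ab ba; have [u [v [z [-> cv bav ua bz]]]] := inversion_in_column rib ab ba.
have ba_neq : a != b by rewrite -val_eqE /= ltn_eqF.
have bu : b \notin u by apply/negP => /ua; lia.
have az : a \notin z by apply/negP => /bz; lia.
have [bv av] := precedes_mem bav.
have nbu : ~~ precedes b a u by apply/negP => /precedes_mem[]; rewrite (negPf bu).
have naz : ~~ precedes b a z by apply/negP => /precedes_mem[_]; rewrite (negPf az).
rewrite !filter_cat !count_cat.
rewrite (pair_projection_sorted ba_neq nbu) (pair_projection_sorted ba_neq naz).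
rewrite (count_memPn bu) (count_memPn az) !(count_uniq_mem _ (column_uniq cv)).
rewrite av bv cats0 addn0 addn1 add0n add1n [in RHS]/=.
rewrite -[[:: b, a & _]]/([:: b; a] ++ _); congr (_ ++ (_ ++ _)).
apply: (irr_sorted_eq gt_trans); rewrite ?sorted_filter ?andbT //.
- by move=> x /=; rewrite ltnn.
- exact: gt_trans.
- by rewrite /= ab.
move=> x; rewrite mem_filter !inE orbC.
by case: eqP => [-> | _]; [rewrite bv | case: eqP => // ->; rewrite av].
Qed.

(** By induction on b - a: if a letter c that occurs lies strictly between a
and b, the inversion splits in u into those of b, c and of c, a, around a single
occurrence of c; they transfer to v and compose there. Otherwise a and b are
neighbours in the support. *)
Lemma ribbon_inversions_sub u v b a :
    quasi_ribbon u -> quasi_ribbon v -> same_inversions u v -> a < b ->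
  precedes b a u -> precedes b a v.
Proof.
move=> ru rv [uv inv]; have [k] := ubnP (b - a).
elim: k a b => // k IH a b abk ab ba.
have [/hasP[c cu /andP[ac cb]] | no] := boolP (has (fun c => a < c < b) u).
  have acb : a < c < b by rewrite ac.
  have [c1 bc ca] := inversion_interpolates ru acb ba cu.
  apply: (@precedes_trans_uniq _ b c a); first by rewrite -(permP uv).
    by apply: IH bc => //; lia.
  by apply: IH ca => //; lia.
by rewrite -inv // => c cu; have := hasPn no c cu.
Qed.

(** The projection of a quasi-ribbon word to a < b is sorted except for at most
one inversion b a, so it is known from the numbers of occurrences and from
whether b precedes a. *)
Lemma quasi_ribbon_unique u v :
  quasi_ribbon u -> quasi_ribbon v -> same_inversions u v -> u = v.
Proof.
move=> ru rv uv; have [puv _] := uv.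
have eq_lt a b : a < b -> filter (pred2 a b) u = filter (pred2 a b) v.
  move=> ab; have inv : precedes b a u = precedes b a v.
    by apply/idP/idP; apply: ribbon_inversions_sub => //; exact: same_inversions_sym.
  have [ba | nba] := boolP (precedes b a u).
    by rewrite !pair_projection_inverted // -?inv // !(permP puv).
  rewrite !pair_projection_sorted -?inv // ?(permP puv) //;
    by rewrite -val_eqE /= ltn_eqF.
apply: eq_from_pair_projections => a b; case: (ltngtP a b) => [|ba|/val_inj <-].
- exact: eq_lt.
- have ab_ba : pred2 a b =1 pred2 b a by move=> x /=; rewrite orbC.
  by rewrite !(eq_filter ab_ba) eq_lt.
have aa_a : pred2 a a =1 pred1 a by move=> x /=; rewrite orbb.
rewrite !(eq_filter aa_a).
have fE w : filter (pred1 a) w = nseq (count_mem a w) a.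
  by elim: w => //= x w ->; case: eqP => // ->.
by rewrite !fE (permP puv).
Qed.

(** * Reducing words that are not quasi-ribbon words *)

Fixpoint inversions u : nat :=
  if u is x :: v then count (fun y => y < x) v + inversions v else 0.

Lemma inversions_cat u v : inversions (u ++ v) =
  inversions u + inversions v + \sum_(x <- u) count (fun y => y < x) v.
Proof.
elim: u => [|x u IH] /=; first by rewrite big_nil addn0.
by rewrite IH big_cons count_cat; lia.
Qed.

Lemma inversions_context s t u v : perm_eq u v -> inversions u < inversions v ->
  inversions (s ++ u ++ t) < inversions (s ++ v ++ t).
Proof.
move=> uv lt_uv; rewrite !inversions_cat (perm_big _ uv) /=.
have crossE : \sum_(x <- s) count (fun y => y < x) (v ++ t) =
              \sum_(x <- s) count (fun y => y < x) (u ++ t).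
  by apply: eq_bigr => x _; apply/esym/permP; rewrite perm_cat2r.
by rewrite crossE; lia.
Qed.

Lemma inversions_swap u a c v : a < c ->
  inversions (u ++ [:: a, c & v]) < inversions (u ++ [:: c, a & v]).
Proof.
move=> ac; rewrite -[[:: a, c & v]]/([:: a; c] ++ v) -[[:: c, a & v]]/([:: c; a] ++ v).
apply: inversions_context; first by apply/permP => P /=; lia.
by move=> /=; lia.
Qed.

Lemma column_decomposition_ex w : exists cs, column_decomposition w cs.
Proof.
elim: w => [|x w [cs [-> ccs scs]]]; first by exists [::].
case: cs ccs scs => [|v cs] ccs scs; first by exists [:: [:: x]].
have [xv | xv] := boolP (column (x :: v)).
  exists ((x :: v) :: cs); split=> //.
    by case/andP: ccs => _ ccs; apply/andP; split.
  case: cs scs ccs => //= u cs /andP[vu ->] _; rewrite andbT.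
  by apply: contra vu; exact: (@column_catr [:: x]).
by exists ([:: x] :: v :: cs); split=> //; apply/andP; split.
Qed.

Lemma column_desc u c a v : column (u ++ [:: c, a & v]) -> a < c.
Proof. by move=> /column_catr /andP[]. Qed.

(** Let y be the last letter of v. If the last letter of u is at most y, then u,
which starts above y, descends across y at some c a, and y stands to the right
of it. Otherwise v, which starts at or above the last letter of u, descends
across that letter, which stands to the left. *)
Lemma consecutive_columns_reduce u v :
    u != [::] -> v != [::] -> column u -> column v ->
    ~~ column (u ++ v) -> ~~ head_le_last u v ->
  exists2 w, u ++ v ≡ w & inversions w < inversions (u ++ v).
Proof.
case: u v => [|x u] [|y v] // _ _ cu cv.
have -> : column ((x :: u) ++ y :: v) = (y < last x u).
  move: cu cv; rewrite /column [sorted _ (_ ++ _)]/= cat_path /= => -> ->.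
  by rewrite andbT.
rewrite /head_le_last -leqNgt -ltnNge => uy vx.
have [uv | vu] := leqP (last x u) (last y v).
  have [|s1 [c [a [s2 [uE yc]]]]] :=
    @adjacent_crossing _ (fun c : 'I_n => last y v < c) x u vx.
    by rewrite -leqNgt.
  rewrite -leqNgt => ay.
  have := mem_last y v; move: (last y v) yc ay => m mc am mv {uy vx uv}.
  case/splitPr: mv cv => t1 t2 cv; rewrite uE in cu *; rewrite -catA /=.
  exists (s1 ++ [:: a, c & s2 ++ t1 ++ m :: t2]); last first.
    by apply: inversions_swap; exact: column_desc cu.
  apply: congr_cat; first exact: congr_refl.
  by rewrite catA; exact: swap_before_far.
have [|s1 [c [a [s2 [vE uc]]]]] :=
  @adjacent_crossing _ (fun c : 'I_n => last x u <= c) y v uy.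
  by rewrite -ltnNge.
rewrite -ltnNge => au.
have := mem_last x u; move: (last x u) uc au => m mc am mu {uy vx vu}.
rewrite vE in cv *.
case/splitPr: mu cu => t1 t2 cu.
exists ((t1 ++ m :: t2) ++ s1 ++ [:: a, c & s2]).
  rewrite -!catA /=; apply: congr_cat; first exact: congr_refl.
  by rewrite !catA; exact: swap_after_far.
rewrite !(catA (t1 ++ _)); apply: inversions_swap.
exact: column_desc cv.
Qed.

(** The factor u made of two consecutive columns is enough for a reduction, and
this is where the length 2n comes from. *)
Lemma quasi_ribbon_or_reducible w : quasi_ribbon w \/
  exists s u t v, [/\ w = s ++ u ++ t, size u <= 2 * n, u ≡ v
    & inversions v < inversions u].
Proof.
have [cs [wE ccs scs]] := column_decomposition_ex w.
have [rib | /not_sorted_split[cs1 [u [v [cs2 [csE uv]]]]]] :=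
  boolP (sorted (@head_le_last n) cs); first by left; exists cs.
right; move: ccs scs wE; rewrite csE all_cat => /and3P[_ /andP[u0 cu]].
move=> /andP[/andP[v0 cv] _] /cat_sorted2[_ /= /andP[nuv _]] ->.
have [w' ww' lt_w'] := consecutive_columns_reduce u0 v0 cu cv nuv uv.
exists (flatten cs1), (u ++ v), (flatten cs2), w'; split=> //.
  by rewrite flatten_cat /= -catA.
by rewrite size_cat mul2n -addnn leq_add // column_size.
Qed.

(** * Quasi-ribbon representatives and the rewriting system *)

Lemma hypo_equiv_context s t u v : u ≡ v -> s ++ u ++ t ≡ s ++ v ++ t.
Proof. by move=> uv; rewrite uv. Qed.

Lemma quasi_ribbon_reachable w : exists r,
  [/\ quasi_ribbon r, r ≡ w & inversions r <= inversions w].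
Proof.
have [k] := ubnP (inversions w); elim: k w => // k IH w wk.
have [rib | [s [u [t [v [wE _ uv lt_vu]]]]]] := quasi_ribbon_or_reducible w.
  by exists w; split=> //; exact: congr_refl.
have [puv _] := hypo_same_inversions uv.
have lt_w : inversions (s ++ v ++ t) < inversions w.
  by rewrite wE inversions_context // perm_sym.
have [|r [rib qE le_q]] := IH (s ++ v ++ t); first by lia.
exists r; split=> //; last by lia.
by rewrite qE wE; apply: hypo_equiv_context; symmetry.
Qed.

Lemma quasi_ribbon_equiv_eq u v :
  quasi_ribbon u -> quasi_ribbon v -> u ≡ v -> u = v.
Proof. by move=> ru rv /hypo_same_inversions; exact: quasi_ribbon_unique. Qed.

Lemma Q_spec w : quasi_ribbon (Q w) /\ Q w ≡ w.
Proof.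
have [r [rib rw _]] := quasi_ribbon_reachable w.
have [] := @xgetPex _ w [set r | quasi_ribbon r /\ hypo_class r = hypo_class w]%classic.
  by exists r; split=> //; apply/word_classP.
by move=> rQ /word_classP.
Qed.

Lemma Q_ribbon w : quasi_ribbon (Q w). Proof. by have [] := Q_spec w. Qed.

Lemma Q_equiv w : Q w ≡ w. Proof. by have [] := Q_spec w. Qed.

Lemma Q_eq u v : u ≡ v -> Q u = Q v.
Proof.
move=> uv; apply: quasi_ribbon_equiv_eq; [exact: Q_ribbon..|].
by rewrite !Q_equiv.
Qed.

Lemma Q_inversions_min u v : u ≡ v -> inversions (Q u) <= inversions v.
Proof.
move=> uv; have [r [rib qv le_q]] := quasi_ribbon_reachable v.
suff -> : Q u = r by [].
apply: quasi_ribbon_equiv_eq => //; first exact: Q_ribbon.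
by rewrite Q_equiv uv qv.
Qed.

Lemma Q_inversions_lt w : w <> Q w -> inversions (Q w) < inversions w.
Proof.
move=> wQ; have [rib | [s [u [t [v [wE _ uv lt_vu]]]]]] := quasi_ribbon_or_reducible w.
  case: wQ; apply: quasi_ribbon_equiv_eq => //; first exact: Q_ribbon.
  by rewrite Q_equiv.
have [puv _] := hypo_same_inversions uv.
have := inversions_context s t; rewrite perm_sym in puv => /(_ _ _ puv lt_vu).
rewrite -wE; apply: leq_ltn_trans; apply: Q_inversions_min.
by rewrite wE; exact: hypo_equiv_context.
Qed.

Local Notation T := (hypo_system n).

Lemma step_equiv u v : rewrite_step T u v -> u ≡ v.
Proof.
case=> s [t [l [r [[w [_ _ [-> ->]]] -> ->]]]].
by apply: hypo_equiv_context; symmetry; exact: Q_equiv.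
Qed.

Lemma step_inversions u v : rewrite_step T u v -> inversions v < inversions u.
Proof.
case=> s [t [l [r [[w [wQ _ [-> ->]]] -> ->]]]].
have [puv _] := hypo_same_inversions (Q_equiv w).
by apply: inversions_context => //; exact: Q_inversions_lt.
Qed.

(** A reducible factor f of length at most 2n differs from [Q f], because the
latter has the fewest inversions in its class; so a rule applies to f. *)
Lemma rewrites_Q u : rewrites T u (Q u).
Proof.
have [k] := ubnP (inversions u); elim: k u => // k IH u uk.
have [rib | [s [f [t [v [uE size_f fv lt_vf]]]]]] := quasi_ribbon_or_reducible u.
  suff -> : Q u = u by exact: rt_refl.
  by apply: quasi_ribbon_equiv_eq => //; [exact: Q_ribbon | exact: Q_equiv].
have st : rewrite_step T u (s ++ Q f ++ t).
  exists s, t, f, (Q f); split=> //; exists f; split=> //.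
    by move=> fQ; have := Q_inversions_min fv; rewrite -fQ; lia.
  by rewrite leq_max size_f.
rewrite (Q_eq (step_equiv st)); apply: rt_trans (rt_step _ _ _ _ st) _.
by apply: IH; have := step_inversions st; lia.
Qed.

Lemma rewrites_equiv u v : rewrites T u v -> u ≡ v.
Proof.
elim=> [x y /step_equiv // | x | x y z _ xy _ yz]; first exact: congr_refl.
exact: congr_trans yz.
Qed.

Lemma rewrites_congr u v : rewrites T u v -> congr_gen T u v.
Proof.
elim=> [x y [s [t [l [r [lr -> ->]]]]] | x | x y z _ xy _ yz].
- apply: congr_cat; [exact: congr_refl | apply: congr_cat; [|exact: congr_refl]].
  exact: congr_rule.
- exact: congr_refl.
- exact: congr_trans yz.
Qed.

Lemma hypo_system_congr u v : congr_gen T u v <-> u ≡ v.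
Proof.
split=> [|uv].
  elim=> {u v} [l r [w [_ _ [-> ->]]] | u | u v _ | u v w _ uv _ | u u' v v' _ uu' _ vv'].
  - by symmetry; exact: Q_equiv.
  - exact: congr_refl.
  - exact: congr_sym.
  - exact: congr_trans.
  - exact: congr_cat.
apply: congr_trans (rewrites_congr (rewrites_Q u)) _; rewrite (Q_eq uv).
exact: congr_sym (rewrites_congr (rewrites_Q v)).
Qed.

Lemma hypo_system_finite : finite_system T.
Proof.
split; first exact: finite_finset.
pose N := maxn (2 * n) 4.
(* The words of length at most N are the tuples of some length k < N.+1. *)
apply: (@sub_finite_set _ _ [set (val (projT2 k), Q (val (projT2 k))) | k in
   [set: {k : 'I_N.+1 & k.-tuple 'I_n}]]%classic).
  move=> _ [w [_ wN ->]].
  by exists (Tagged (fun k : 'I_N.+1 => k.-tuple 'I_n)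
       (in_tuple w : (Ordinal (wN : size w < N.+1)).-tuple 'I_n)).
by apply: finite_image; exact: finite_finset.
Qed.

Lemma hypo_system_noetherian : noetherian T.
Proof.
case=> f stf; have bound i : inversions (f i) + i <= inversions (f 0).
  by elim: i => [|i IH]; [rewrite addn0 | have := step_inversions (stf i); lia].
by have := bound (inversions (f 0)).+1; lia.
Qed.

Lemma hypo_system_confluent : confluent T.
Proof.
move=> u v w /rewrites_equiv uv /rewrites_equiv uw; exists (Q u).
by split; [rewrite (Q_eq uv) | rewrite (Q_eq uw)]; exact: rewrites_Q.
Qed.

End HypoplacticCongruence.

Theorem theorem4p5 (n : nat) (n_ge1 : 1 <= n) :
  [/\ finite_system (hypo_system n),
      complete_system (hypo_system n)
    & presents (hypo_system n)
        (fun a : 'I_n => hypo_class [:: a] : hypoplactic n)].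
Proof.
split.
- exact: hypo_system_finite.
- by split; [exact: hypo_system_noetherian | exact: hypo_system_confluent].
- by apply: same_congr_presents => u v; exact: hypo_system_congr.
Qed.
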